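(* $\mathrm{SSCM}(2,1;5;3,2)=\mathrm{RE}$. That is, a language is recursively enumerable if and only if it is generated by a simple semi-conditional matrix grammar of degree $(2,1)$ with at most $5$ nonterminals, at most $3$ conditional matrices, and all matrices of length at most $2$.
   Context: A semi-conditional matrix (SCM) grammar is a quadruple $G=(V,T,M,S)$ with the following components. - $V$ is a finite alphabet and $T\subsetneq V$ is the set of terminals. - $N=V\setminus T$ is the set of nonterminals and $S\in N$ is the start symbol. - $M$ is a finite set of matrices of the form $r=[(A_1\to x_1),\dots,(A_\ell\to x_\ell),P,F]$, where $\ell\ge 1$, $A_k\in N$, $x_k\in V^*$, and $P,F\in V^+\cup\{\emptyset\}$. Here $\emptyset\notin V$ is a special symbol meaning that the condition is absent, and $|\emptyset|=0$. The number $\ell$ is the length of $r$. A matrix is classified as follows: - unconditional if $P=F=\emptyset$, and conditional otherwise; - simple if at least one of $P,F$ equals $\emptyset$, and non-simple if both $P\neq\emptyset$ and $F\neq\emptyset$. For $x,y\in V^*$ we write $x\Rightarrow_r y$ iff all of the following hold: 1. if $P\neq\emptyset$ then $P$ is a subword (factor) of $x$; 2. if $F\neq\emptyset$ then $F$ is not a subword of $x$; 3. there are words $x=y_0,y_1,\dots,y_\ell=y$ such that $y_k$ is obtained from $y_{k-1}$ by replacing one occurrence of $A_k$ by $x_k$. $\Rightarrow_G$ is the union of the relations $\Rightarrow_r$ over $r\in M$, and $L(G)=\{y\in T^*: S\Rightarrow_G^* y\}$. $G$ has degree $(i,j)$ if every matrix satisfies $|P|\le i$ and $|F|\le j$. $\mathrm{SCM}(i,j;n;m,\ell,s)$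 denotes the family of languages $L(G)$ of SCM grammars $G$ that satisfy all of the following: - $G$ has degree $(i,j)$; - $|N|\le n$; - $G$ has at most $m$ conditional matrices; - every matrix of $G$ has length at most $\ell$; - $G$ has at most $s$ non-simple matrices. A $*$ in a parameter position means that parameter is unbounded. $\mathrm{SSCM}(i,j;n;m,\ell)=\mathrm{SCM}(i,j;n;m,\ell,0)$, i.e., all matrices are simple. $\mathrm{RE}$ is the class of recursively enumerable languages. *)

(* Defs.v *)
From Stdlib Require List.
From mathcomp Require Import all_boot.
Set Implicit Arguments. Unset Strict Implicit. Unset Printing Implicit Defensive.

(* Symbols: terminals T (a finite alphabet) and nonterminals 'I_k. *)
Definition sym (T : finType) (k : nat) : Type := (T + 'I_k)%type.

Inductive star (X : Type) (R : X -> X -> Prop) : X -> X -> Prop :=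
  | star_refl x : star R x x
  | star_step x y z : R x y -> star R y z -> star R x z.

(* A matrix [(A_1 -> x_1), ..., (A_l -> x_l), P, F];
   None encodes the absent condition (the symbol "emptyset"). *)
Record scm_matrix (T : finType) (k : nat) := SCMMatrix {
  mrules : seq ('I_k * seq (sym T k));
  mP : option (seq (sym T k));
  mF : option (seq (sym T k)) }.

Record scm_grammar (T : finType) (k : nat) := SCMGrammar {
  gstart : 'I_k;
  gmats : seq (scm_matrix T k) }.

Definition opt_size (X : Type) (o : option (seq X)) : nat :=
  if o is Some p then size p else 0.

Definition scm_matrix_wf T k (r : scm_matrix T k) : bool :=
  [&& 0 < size (mrules r),
      (if mP r is Some p then 0 < size p else true) &
      (if mF r is Some f then 0 < size f else true)].

Definition conditional T k (r : scm_matrix T k) : bool :=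
  isSome (mP r) || isSome (mF r).
Definition nonsimple T k (r : scm_matrix T k) : bool :=
  isSome (mP r) && isSome (mF r).

Definition replace1 T k (A : 'I_k) (w : seq (sym T k)) (x y : seq (sym T k)) : Prop :=
  exists u v, x = u ++ inr A :: v /\ y = u ++ w ++ v.

Inductive apply_rules T k :
    seq ('I_k * seq (sym T k)) -> seq (sym T k) -> seq (sym T k) -> Prop :=
  | ar_nil x : apply_rules [::] x x
  | ar_cons A w rs x y z :
      replace1 A w x y -> apply_rules rs y z -> apply_rules ((A, w) :: rs) x z.

Definition mat_step T k (r : scm_matrix T k) (x y : seq (sym T k)) : Prop :=
  (if mP r is Some p then infix p x else true) /\
  (if mF r is Some f then ~~ infix f x else true) /\
  apply_rules (mrules r) x y.

Definition scm_step T k (G : scm_grammar T k) (x y : seq (sym T k)) : Prop :=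
  exists r, List.In r (gmats G) /\ mat_step r x y.

Definition scm_lang T k (G : scm_grammar T k) (w : seq T) : Prop :=
  star (scm_step G) [:: inr (gstart G)] (map inl w).

Definition scm_bounded T k (i j m l s : nat) (G : scm_grammar T k) : bool :=
  [&& all (@scm_matrix_wf T k) (gmats G),
      all (fun r => opt_size (mP r) <= i) (gmats G),
      all (fun r => opt_size (mF r) <= j) (gmats G),
      count (@conditional T k) (gmats G) <= m,
      all (fun r => size (mrules r) <= l) (gmats G) &
      count (@nonsimple T k) (gmats G) <= s].

Definition SCM (i j n m l s : nat) (T : finType) (L : seq T -> Prop) : Prop :=
  exists k, k <= n /\ exists G : scm_grammar T k,
    scm_bounded i j m l s G /\ forall w, L w <-> scm_lang G w.

Definition SSCM (i j n m l : nat) (T : finType) (L : seq T -> Prop) : Prop :=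
  SCM i j n m l 0 L.

(* RE = languages generated by (unrestricted) phrase-structure grammars. *)

Record ps_grammar (T : finType) (k : nat) := PSGrammar {
  pstart : 'I_k;
  prules : seq (seq (sym T k) * seq (sym T k)) }.

Definition is_nonterm T k (a : sym T k) : bool := if a is inr _ then true else false.

Definition ps_wf T k (G : ps_grammar T k) : bool :=
  all (fun ab => has (@is_nonterm T k) ab.1) (prules G).

Definition ps_step T k (G : ps_grammar T k) (x y : seq (sym T k)) : Prop :=
  exists u v a b, List.In (a, b) (prules G) /\ x = u ++ a ++ v /\ y = u ++ b ++ v.

Definition ps_lang T k (G : ps_grammar T k) (w : seq T) : Prop :=
  star (ps_step G) [:: inr (pstart G)] (map inl w).

Definition RE (T : finType) (L : seq T -> Prop) : Prop :=
  exists k (G : ps_grammar T k), ps_wf G /\ forall w, L w <-> ps_lang G w.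

(* Main.v *)
Require Import Defs.
From mathcomp Require Import all_boot.
Set Implicit Arguments. Unset Strict Implicit. Unset Printing Implicit Defensive.

(** From a phrase-structure grammar to a semi-conditional one: the derivation
    history of a word is checked by a Post correspondence, as in Geffert's
    normal forms. A nonterminal [X] emits on its left the word followed by a
    code over [{A, C}] and on its right the mirrored code over [{B, C}] of a
    second string; the two strings agree exactly when the history is a
    derivation. Agreement is tested by cancelling [AB] and [CC] at the centre:
    a conditional matrix forbidding [S] overwrites an [A] and a [B], or two
    [C]s, by [S], and the matrix requiring [SS] erases the two [S]s. The codes
    have no factor [CC], so only the two letters at the centre can be adjacent.

    Conversely, a phrase-structure grammar moves a head over the sentential
    form: it checks a required factor locally, a forbidden letter by a sweep
    from end to end, and then applies the rules of the matrix one at a time. *)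

(** * Derivations in several steps and factorizations of words *)

Lemma star_trans (X : Type) (R : X -> X -> Prop) x y z :
  star R x y -> star R y z -> star R x z.
Proof. by elim=> // a b c Rab _ IH /IH; apply: star_step. Qed.

Lemma star1 (X : Type) (R : X -> X -> Prop) x y : R x y -> star R x y.
Proof. by move=> Rxy; apply: (star_step Rxy); apply: star_refl. Qed.

Lemma InP (X : eqType) (x : X) s : reflect (List.In x s) (x \in s).
Proof.
elim: s => [|y s IH] /=; first by constructor.
rewrite inE eq_sym; apply: (iffP orP) => -[h|/IH h]; [left|right|left|right] => //.
  exact/eqP.
exact/eqP.
Qed.

(** Since [u] and [v] hold no letter satisfying [P], the letter [c'] can only sit where [c] does.
    This locates the unique [X] of a sentential form and, later, the unique head. *)
Lemma cat_cons_inj (X : Type) (P : pred X) u v u' v' c c' :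
  P c -> P c' -> ~~ has P u -> ~~ has P v ->
  u ++ c :: v = u' ++ c' :: v' -> [/\ u = u', c = c' & v = v'].
Proof.
move=> Pc Pc'; elim: u u' => [|d u IH] [|d' u'] //=.
- by move=> _ _ [-> ->].
- move=> _ nv [_ e]; move: nv; by rewrite e has_cat /= Pc' orbT.
- by rewrite negb_or => /andP[nd _] _ [e]; rewrite e Pc' in nd.
- by rewrite negb_or => /andP[_ nu] nv [-> /(IH _ nu nv)[-> -> ->]].
Qed.

Lemma cat_cons2_cases (X : Type) (e r u v : seq X) p q :
  e ++ r = u ++ [:: p, q & v] ->
  [\/ exists v', e = u ++ [:: p, q & v'],
      e = rcons u p /\ r = q :: v |
      exists2 u', u = e ++ u' & r = u' ++ [:: p, q & v]].
Proof.
elim: e u => [|c e IH] [|d u] /=; try by move=> ->; constructor 3; eexists.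
  case: e {IH} => [|c' e] /= [<-]; first by move=> ->; constructor 2.
  by move=> [<- _]; constructor 1; exists e.
case=> <- /IH[[v' ->]|[-> ->]|[u' -> ->]].
- by constructor 1; exists v'.
- by constructor 2.
- by constructor 3; exists u'.
Qed.

(** * Tile systems as semi-conditional grammars *)

Section PostSystem.

Variables (T : finType) (Sg : countType).

Definition tile : Type := (seq (T + Sg) * seq Sg)%type.

Definition lefts (s : seq tile) := flatten (unzip1 s).
Definition rights (s : seq tile) := flatten (unzip2 s).

(** A Post correspondence with a tail: one tile sequence spells both sides, [f] closes the left one,
    and [w] is what the left side has in front of the right one. *)
Definition post_lang (ts : seq tile) (f : seq (T + Sg)) (w : seq T) : Prop :=
  exists s : seq tile, {subset s <= ts} /\
    lefts s ++ f = map inl w ++ map inr (rights s).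

Definition nX : 'I_5 := @Ordinal 5 0 isT.
Definition nA : 'I_5 := @Ordinal 5 1 isT.
Definition nB : 'I_5 := @Ordinal 5 2 isT.
Definition nC : 'I_5 := @Ordinal 5 3 isT.
Definition nS : 'I_5 := @Ordinal 5 4 isT.

Local Notation letter := (sym T 5).
Local Notation X := (inr nX : letter).
Local Notation A := (inr nA : letter).
Local Notation B := (inr nB : letter).
Local Notation C := (inr nC : letter).
Local Notation S := (inr nS : letter).

(** [bar c] is the letter that cancels [c] at the centre: [A] faces [B], and [C] faces [C]. *)
Definition bar (c : letter) : letter :=
  if c == A then B else if c == B then A else c.

Lemma barK : involutive bar.
Proof.
move=> c; rewrite /bar; case: (c =P A) => [->|/eqP/negPf cA] //.
by case: (c =P B) => [->|/eqP/negPf cB] //; rewrite cA cB.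
Qed.

(** The block of [A] is never empty, so concatenated codes have no factor [CC]; the closing [C]
    makes them uniquely decodable. *)
Definition enc (x : Sg) : seq letter := rcons (nseq (pickle x).+1 A) C.

Definition encl (l : seq (T + Sg)) : seq letter :=
  flatten [seq if y is inr x then enc x else
               if y is inl a then [:: inl a] else [::] | y <- l].

Definition encr (r : seq Sg) : seq letter := rev (map bar (encl (map inr r))).

Lemma encl_cat l1 l2 : encl (l1 ++ l2) = encl l1 ++ encl l2.
Proof. by rewrite /encl map_cat flatten_cat. Qed.

Lemma encl_inl (w : seq T) : encl (map inl w) = map inl w.
Proof. by elim: w => //= a w <-. Qed.

Lemma encr_cat r1 r2 : encr (r1 ++ r2) = encr r2 ++ encr r1.
Proof. by rewrite /encr map_cat encl_cat map_cat rev_cat. Qed.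

Lemma encl_inj : injective encl.
Proof.
elim=> [|y l IH] [|y' l'] //.
- by case: y'.
- by case: y.
case: y y' => [a|x] [a'|x'] //.
  by case=> -> /IH->.
rewrite /encl /= -/(encl l) -/(encl l') !cat_rcons => -[].
move=> e; suff [xx' ll'] : pickle x = pickle x' /\ encl l = encl l'.
  by rewrite (IH _ ll') (pcan_inj pickleK xx').
move: (pickle x) (pickle x') e; elim=> [|n IHn] [|m] //= [].
  by move=> ->.
by case/IHn=> -> ->.
Qed.

Definition nCC (c d : letter) := ~~ ((c == C) && (d == C)).
Definition isL (c : letter) := [|| ~~ is_nonterm c, c == A | c == C].
Definition isQ (c : letter) := (c == A) || (c == C).

(** Each entry starts with a terminal or an [A], and the [C] of a code follows an [A]. The arbitrary
    preceding letter [c] carries the induction. *)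
Lemma path_encl c l : path nCC c (encl l).
Proof.
elim: l c => //= -[a|x] l IH c.
  by rewrite /= IH andbT /nCC andbF.
rewrite cat_path IH andbT rcons_path /=.
rewrite {1}/nCC andbF /=.
by elim: (pickle x) => [|n] //=; rewrite last_nseq.
Qed.

Lemma sorted_encl l : sorted nCC (encl l).
Proof. exact: path_sorted (path_encl C l). Qed.

Lemma isL_encl l : all isL (encl l).
Proof.
elim: l => //= -[a|x] l IH //.
by rewrite all_cat IH andbT all_rcons all_nseq orbT.
Qed.

Lemma isQ_encl r : all isQ (encl (map inr r)).
Proof.
by elim: r => //= x r IH; rewrite all_cat IH andbT all_rcons all_nseq orbT.
Qed.

Lemma infix1 (s : seq letter) c : infix [:: c] s = (c \in s).
Proof.
by elim: s => //= d s IH; rewrite inE -IH prefix0s andbT.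
Qed.

Lemma sorted_nCC u v : ~~ sorted nCC (u ++ [:: C, C & v]).
Proof. by case: u => [|c u] //=; rewrite cat_path /= /nCC /= !andbF. Qed.

(** * The grammar of a tile system and the words it generates *)

Variables (ts : seq tile) (f : seq (T + Sg)).

Definition post_scm : scm_grammar T 5 := SCMGrammar nX
  ([seq SCMMatrix [:: (nX, encl t.1 ++ X :: encr t.2)] None None | t <- ts] ++
   [:: SCMMatrix [:: (nX, encl f)] None None;
       SCMMatrix [:: (nA, [:: S]); (nB, [:: S])] None (Some [:: S]);
       SCMMatrix [:: (nC, [:: S]); (nC, [:: S])] None (Some [:: S]);
       SCMMatrix [:: (nS, [::]); (nS, [::])] (Some [:: S; S]) None]).

Lemma post_scm_bounded : scm_bounded 2 1 3 2 0 post_scm.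
Proof.
rewrite /scm_bounded /= !all_cat !count_cat /= !all_map !count_map /=.
by rewrite !all_predT !count_pred0.
Qed.

Inductive post_step : seq letter -> seq letter -> Prop :=
| step_tile t u v : t \in ts ->
    post_step (u ++ X :: v) (u ++ encl t.1 ++ X :: encr t.2 ++ v)
| step_final u v : post_step (u ++ X :: v) (u ++ encl f ++ v)
| step_mark c d x y z : (c, d) = (nA, nB) \/ (c, d) = (nC, nC) -> S \notin x ->
    replace1 c [:: S] x y -> replace1 d [:: S] y z -> post_step x z
| step_del x y z : infix [:: S; S] x ->
    replace1 nS [::] x y -> replace1 nS [::] y z -> post_step x z.

Lemma post_scmE x y : scm_step post_scm x y <-> post_step x y.
Proof.
split.
  case=> r [/List.in_app_iff[]] /=.
    case/List.in_map_iff=> t [<- /InP tts] [_ [_ /=]].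
    move=> h; inversion h as [|? ? ? ? y' ? h1 h2]; subst; inversion h2; subst.
    by case: h1 => u [v [-> ->]]; rewrite -catA; apply: step_tile.
  case=> [<-|[<-|[<-|[<-|//]]]] [/= P [/= F]].
  - move=> h; inversion h as [|? ? ? ? y' ? h1 h2]; subst; inversion h2; subst.
    by case: h1 => u [v [-> ->]]; apply: step_final.
  - move=> h; inversion h as [|? ? ? ? y' ? h1 h2]; subst.
    inversion h2 as [|? ? ? ? y2 ? h3 h4]; subst; inversion h4; subst.
    by apply: (step_mark _ _ h1 h3); [left|rewrite -infix1].
  - move=> h; inversion h as [|? ? ? ? y' ? h1 h2]; subst.
    inversion h2 as [|? ? ? ? y2 ? h3 h4]; subst; inversion h4; subst.
    by apply: (step_mark _ _ h1 h3); [right|rewrite -infix1].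
  - move=> h; inversion h as [|? ? ? ? y' ? h1 h2]; subst.
    inversion h2 as [|? ? ? ? y2 ? h3 h4]; subst; inversion h4; subst.
    exact: step_del P h1 h3.
have two c w d w' (x1 y1 z1 : seq letter) : replace1 c w x1 y1 -> replace1 d w' y1 z1 ->
    apply_rules [:: (c, w); (d, w')] x1 z1.
  by move=> h1 h2; apply: ar_cons h1 _; apply: ar_cons h2 _; apply: ar_nil.
case=> [t u v tts|u v|c d x1 y1 z1 cd nS1 h1 h2|x1 y1 z1 i1 h1 h2].
- eexists; split; first by apply/List.in_app_iff; left; apply/List.in_map_iff; exists t; split=> //; apply/InP.
  split=> //; split=> //=; apply: ar_cons (ar_nil _).
  by exists u, v; rewrite -catA.
- eexists; split; first by apply/List.in_app_iff; right; left.
  split=> //; split=> //=; apply: ar_cons (ar_nil _).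
  by exists u, v.
- case: cd => -[ec ed]; subst c d; eexists.
    split; first by apply/List.in_app_iff; right; right; left.
    by split=> //; split; [rewrite /= infix1|apply: two h1 h2].
  split; first by apply/List.in_app_iff; right; right; right; left.
  by split=> //; split; [rewrite /= infix1|apply: two h1 h2].
- eexists; split; first by apply/List.in_app_iff; right; right; right; right; left.
  by split=> //; split=> //; apply: two h1 h2.
Qed.

Lemma post_scm_complete w : post_lang ts f w -> scm_lang post_scm w.
Proof.
case=> s [sts eqw].
have gen s1 : {subset s1 <= ts} -> forall u v,
    star (scm_step post_scm) (u ++ X :: v) (u ++ encl (lefts s1) ++ X :: encr (rights s1) ++ v).
  elim: s1 => [|t s1 IH] sub u v; first exact: star_refl.
  have tts : t \in ts by apply: sub; rewrite mem_head.
  have {}IH := IH (fun x xs => sub x (mem_behead (s := t :: s1) xs)).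
  apply: star_step; first by apply/post_scmE; apply: step_tile tts.
  have := IH (u ++ encl t.1) (encr t.2 ++ v).
  by rewrite /lefts /rights /= encl_cat encr_cat -!catA.
(* The last letter of [q] faces its own mirror image at the centre; one marking and one deletion
   remove both. *)
have cancel q : all isQ q ->
    star (scm_step post_scm) (map inl w ++ q ++ rev (map bar q)) (map inl w).
  elim/last_ind: q => [|q c IH]; first by rewrite /= cats0 => _; apply: star_refl.
  rewrite all_rcons => /andP[cQ qQ]; apply: star_trans (IH qQ).
  rewrite map_rcons rev_rcons cat_rcons.
  set u := map inl w ++ q; set v := rev _.
  rewrite -/(_ :: v) [_ ++ q ++ c :: _]catA [_ ++ q ++ v]catA -/u.
  have nSu : S \notin u ++ [:: c, bar c & v].
    rewrite /u /v -catA !mem_cat !inE mem_rev !negb_or; apply/and5P; split.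
    - by apply/mapP=> -[].
    - by apply/negP=> /(allP qQ).
    - by case/orP: cQ => /eqP->.
    - by case/orP: cQ => /eqP->.
    - by apply/mapP=> -[b /(allP qQ)/orP[]/eqP->].
  apply: (@star_step _ _ _ (u ++ [:: S, S & v])).
    apply/post_scmE; have [c' cE] : exists c', c = inr c' by case/orP: cQ => /eqP->; eexists.
    case/orP: cQ cE nSu => /eqP-> _ nSu.
      apply: (step_mark (or_introl erefl) nSu); first by exists u, (B :: v).
      by exists (rcons u S), v; rewrite !cat_rcons.
    apply: (step_mark (or_intror erefl) nSu); first by exists u, (C :: v).
    by exists (rcons u S), v; rewrite !cat_rcons.
  apply: star1; apply/post_scmE; apply: (@step_del _ (u ++ S :: v)).
  - by apply/infixP; exists u, v.
  - by exists u, (S :: v).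
  - by exists u, v.
apply: (star_trans (gen s sts [::] [::])); rewrite /= cats0.
apply: (star_step _ (y := encl (lefts s) ++ encl f ++ encr (rights s))).
  by apply/post_scmE; apply: step_final.
rewrite catA -encl_cat eqw encl_cat encl_inl -catA.
exact: cancel (isQ_encl _).
Qed.

(** What a reachable word becomes once the letters overwritten by [S] are restored: before the final
    step a pair of codes around [X], afterwards a left word [e] facing the mirror of [q]. The last
    clause survives a cancellation, because putting the same letter back at the end of [e] and [q]
    restores the earlier equation. *)
Definition core (x : seq letter) : Prop :=
  (exists2 s, {subset s <= ts} & x = encl (lefts s) ++ X :: encr (rights s)) \/
  (exists e q, [/\ x = e ++ rev (map bar q), all isL e && all isQ q,
     sorted nCC e, sorted nCC q & forall w, e = map inl w ++ q -> post_lang ts f w]).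


(** The marked pairs in order of position. [B A] is listed because a marking matrix may pick a [B]
    standing before the [A]. *)
Definition annihilating : seq (seq letter) := [:: [:: A; B]; [:: B; A]; [:: C; C]].

(** A left word has no [B], which excludes two of the pairs, and no factor [CC]. *)
Lemma annihilating_freeL e u p q v : all isL e -> sorted nCC e ->
  [:: p; q] \in annihilating -> e <> u ++ [:: p, q & v].
Proof.
move=> eL eC pq ee; move: eL eC; rewrite ee all_cat => /and4P[_ pL qL _].
move: pq; rewrite !inE => /or3P[] /eqP[ep eq]; subst p q => //.
by rewrite (negPf (sorted_nCC _ _)).
Qed.

(** Undoing the mirror turns a right word into a left one and maps each of the three pairs to
    itself. *)
Lemma annihilating_freeR s u p q v : all isQ s -> sorted nCC s ->
  [:: p; q] \in annihilating -> rev (map bar s) <> u ++ [:: p, q & v].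
Proof.
move=> sQ sC pq es.
have {}es : s = map bar (rev v) ++ [:: bar q, bar p & map bar (rev u)].
  rewrite -[LHS](mapK barK) -[map bar s]revK es rev_cat !rev_cons map_cat.
  by rewrite !map_rcons !cat_rcons.
apply: annihilating_freeL es => //; first by apply: sub_all sQ => c cQ; rewrite /isL -/(isQ c) cQ orbT.
by move: pq; rewrite !inE => /or3P[] /eqP[-> ->].
Qed.

Lemma notin_isL c e : c != A -> c != C -> is_nonterm c -> all isL e -> c \notin e.
Proof.
by move=> /negPf cA /negPf cC ct /allP eL; apply/negP=> /eL; rewrite /isL ct cA cC.
Qed.

Lemma notin_isQ c s : bar c != A -> bar c != C -> all isQ s -> c \notin rev (map bar s).
Proof.
move=> /negPf cA /negPf cC /allP sQ; rewrite mem_rev -(barK c) (mem_map (inv_inj barK)).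
by apply/negP=> /sQ; rewrite /isQ cA cC.
Qed.

Lemma core_noS x : core x -> S \notin x.
Proof.
case=> [[s _ ->]|[e [q [-> /andP[eL qQ] _ _ _]]]].
  by rewrite mem_cat inE !negb_or (notin_isL _ _ _ (isL_encl _)) ?(notin_isQ _ _ (isQ_encl _)).
by rewrite mem_cat negb_or (notin_isL _ _ _ eL) ?(notin_isQ _ _ qQ).
Qed.

(** [X] occurs once, so the given factorization is the one in [core]. At the final step, injectivity
    of [encl] turns an equality of codes into the equation of [post_lang]. *)
Lemma core_X u v : core (u ++ X :: v) ->
  (forall t, t \in ts -> core (u ++ encl t.1 ++ X :: encr t.2 ++ v)) /\
  core (u ++ encl f ++ v).
Proof.
case=> [[s sts ee]|[e [q [ee /andP[eL qQ] _ _ _]]]]; last first.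
  have: X \in e ++ rev (map bar q) by rewrite -ee mem_cat mem_head orbT.
  by rewrite mem_cat (negPf (notin_isL _ _ _ eL)) ?(negPf (notin_isQ _ _ qQ)).
have [] := @cat_cons_inj _ (pred1 X) _ _ _ _ _ _ (eqxx X) (eqxx X) _ _ (esym ee).
- by rewrite has_pred1 (notin_isL _ _ _ (isL_encl _)).
- by rewrite has_pred1 (notin_isQ _ _ (isQ_encl _)).
move=> <- _ <-; split=> [t tts|].
  left; exists (rcons s t).
    by move=> t'; rewrite mem_rcons inE => /orP[/eqP->|/sts].
  rewrite /lefts /rights /unzip1 /unzip2 !map_rcons -!cats1 !flatten_cat /= !cats0.
  by rewrite encl_cat encr_cat -!catA.
right; exists (encl (lefts s ++ f)), (encl (map inr (rights s))); split.
- by rewrite encl_cat -catA.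
- by rewrite isL_encl isQ_encl.
- exact: sorted_encl.
- exact: sorted_encl.
by move=> w; rewrite -encl_inl -encl_cat => /encl_inj ew; exists s.
Qed.

(** Neither half contains a cancelling pair, and while [X] is present the halves do not touch. So
    the pair straddles the centre, and deleting it drops the same last letter from both words
    compared in [core]. *)
Lemma core_del u p q v : core (u ++ [:: p, q & v]) ->
  [:: p; q] \in annihilating -> core (u ++ v).
Proof.
move=> h pq; case: h => [[s sts /esym ex]|[e [r [/esym ex]]]].
  case: (cat_cons2_cases ex) => [[v' /annihilating_freeL[]]|[_ [eq _]]|[[|c u'] _]] //.
  - exact: isL_encl.
  - exact: sorted_encl.
  - by move: pq; rewrite -eq !inE => /or3P[] /eqP[].
  - by case=> ep _; move: pq; rewrite -ep.
  case=> _ /annihilating_freeR[] //; [exact: isQ_encl | exact: sorted_encl].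
case: (cat_cons2_cases ex) => [[v' ee]|[ee er]|[u' _ ee]] /andP[eL rQ] eC rC Phi.
- by case: (annihilating_freeL eL eC pq ee).
- case/lastP: r {ex} er rQ rC Phi => [|r c] //.
  rewrite map_rcons rev_rcons => -[ecq <-]; rewrite all_rcons => /andP[cQ rQ] rC Phi.
  (* [B A] is impossible since [e] has no [B]; in the other two pairs [q] is [bar p]. *)
  have ecp : c = p.
    move: eL; rewrite ee all_rcons => /andP[pL _].
    move: pq pL; rewrite -[c]barK ecq !inE => /or3P[] /eqP[-> ->] //.
  right; exists u, r; split=> //.
  - by move: eL; rewrite ee all_rcons => /andP[_ ->].
  - by move: eC; rewrite ee -cats1 => /cat_sorted2[].
  - by move: rC; rewrite -cats1 => /cat_sorted2[].
  by move=> w eu; apply: Phi; rewrite ee eu -rcons_cat ecp.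
- by case: (annihilating_freeR rQ rC pq ee).
Qed.

(** A nonempty mirrored part would begin with [B] or [C], so [q] is empty and the last clause of
    [core] applies. *)
Lemma core_terminal w : core (map inl w) -> post_lang ts f w.
Proof.
have noX c s : (inr c : letter) \in map inl (s : seq T) -> False by case/mapP.
case=> [[s _ ee]|[e [q [ee /andP[_ qQ] _ _ Phi]]]].
  by case: (@noX nX w); rewrite ee mem_cat mem_head orbT.
case/lastP: q ee qQ Phi => [|q c] ee qQ Phi; first by apply: Phi; rewrite ee !cats0.
move: ee qQ; rewrite map_rcons rev_rcons all_rcons => ee /andP[/orP[]/eqP ec _].
  by case: (@noX nB w); rewrite ee mem_cat ec mem_head orbT.
by case: (@noX nC w); rewrite ee mem_cat ec mem_head orbT.
Qed.

(* A letter paired with [true] is one currently overwritten by [S]. *)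
Definition visible (p : letter * bool) : letter := if p.2 then S else p.1.
Definition marked (z : seq (letter * bool)) := [seq p.1 | p <- z & p.2].

(** Tile steps may occur between a marking and the deletion of the marks, so the invariant concerns
    the word with its marks undone and records which letters are marked. *)
Definition post_inv (y : seq letter) : Prop :=
  exists z, [/\ y = map visible z, core (unzip1 z) &
                marked z \in [::] :: annihilating].

Lemma map_eq_cat_cons (U V : Type) (g : U -> V) z u c v : map g z = u ++ c :: v ->
  exists z1 p z2, [/\ z = z1 ++ p :: z2, map g z1 = u, g p = c & map g z2 = v].
Proof.
elim: u z => [|d u IH] [|p z] //= [].
  by move=> <- <-; exists [::], p, z.
by move=> <- /IH[z1 [p' [z2 [-> <- <- <-]]]]; exists (p :: z1), p', z2.
Qed.

Lemma marked_cat z1 z2 : marked (z1 ++ z2) = marked z1 ++ marked z2.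
Proof. by rewrite /marked filter_cat map_cat. Qed.

Lemma marked_cons p z : marked (p :: z) = if p.2 then p.1 :: marked z else marked z.
Proof. by rewrite /marked /=; case: p.2. Qed.

Lemma mark_letter c z y : c <> nS -> replace1 c [:: S] (map visible z) y ->
  exists z1 z2, z = z1 ++ (inr c, false) :: z2 /\
    y = map visible (z1 ++ (inr c, true) :: z2).
Proof.
move=> cS [u [v [ez ->]]].
have [z1 [[d b] [z2 [-> <- ec <-]]]] := map_eq_cat_cons ez.
exists z1, z2; rewrite map_cat /=; case: b ec; rewrite /visible /= => ec; last by rewrite ec.
by case: cS; case: ec.
Qed.

Lemma filter_visible z : S \notin unzip1 z ->
  [seq c <- map visible z | c != S] = [seq p.1 | p <- z & ~~ p.2].
Proof.
elim: z => // -[c b] z IH /=; rewrite inE negb_or eq_sym => /andP[cS /IH zE].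
by rewrite /visible; move: b => []; rewrite /= ?cS zE.
Qed.

Lemma count_visible z : S \notin unzip1 z ->
  count_mem S (map visible z) = size (marked z).
Proof.
elim: z => // -[c b] z IH /=; rewrite inE negb_or eq_sym => /andP[/negPf cS /IH ->].
by rewrite /visible; move: b => [] //=; rewrite cS.
Qed.

Lemma unmarked z : marked z = [::] -> [seq p.1 | p <- z & ~~ p.2] = unzip1 z.
Proof. by elim: z => //= -[c []] z IH //= /IH->. Qed.

Lemma replace1_delS x y : replace1 nS [::] x y ->
  [seq c <- x | c != S] = [seq c <- y | c != S] /\ count_mem S x = (count_mem S y).+1.
Proof. by case=> u [v [-> ->]]; rewrite !filter_cat !count_cat /= addnS. Qed.

Lemma post_inv_core x : core x -> post_inv x.
Proof.
move=> cx; exists [seq (c, false) | c <- x]; split.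
- by rewrite -map_comp map_id.
- by rewrite /unzip1 -map_comp map_id.
by rewrite /marked; elim: x {cx}.
Qed.

(** A visible [X] is unmarked, so the step acts on the underlying word; the inserted letters are
    unmarked and the marked ones stay the same. *)
Lemma post_inv_X w u v :
  (forall u' v', core (u' ++ X :: v') -> core (u' ++ w ++ v')) ->
  post_inv (u ++ X :: v) -> post_inv (u ++ w ++ v).
Proof.
move=> cw [z [ey cz mz]].
have [z1 [[c b] [z2 [ez <- ec <-]]]] := map_eq_cat_cons (esym ey).
move: b ec ez => [] //; rewrite /visible /= => -> ez; subst z.
exists (z1 ++ [seq (d, false) | d <- w] ++ z2); split.
- by rewrite !map_cat -map_comp map_id.
- move: cz; rewrite /unzip1 !map_cat -map_comp /= => /cw.
  by rewrite map_id.
move: mz; rewrite !marked_cat !marked_cons /=.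
by rewrite {4}/marked; have -> : [seq p <- [seq (d, false) | d <- w] | p.2] = [::] by elim: w {cw}.
Qed.

Lemma post_inv_step y y' : post_inv y -> post_step y y' -> post_inv y'.
Proof.
move=> iy st; case: st iy => [t u v tts|u v|c d x y1 z1 cd nSx r1 r2|x y1 z1 ss r1 r2].
- move=> iy; have := @post_inv_X (encl t.1 ++ X :: encr t.2) u v.
  by rewrite -!catA; apply=> // u' v' /core_X[/(_ t tts) + _]; rewrite -!catA.
- by apply: post_inv_X => u' v' /core_X[].
- case=> z [ex cz mz]; subst x.
  (* The forbidden [S] is absent, so nothing was marked before, and afterwards exactly the two
     chosen letters are. *)
  have {}mz : marked z = [::].
    by apply: size0nil; rewrite -count_visible ?core_noS // (count_memPn nSx).
  have [cS dS] : c <> nS /\ d <> nS by case: cd => -[-> ->].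
  have [z2 [z3 [ez ey]]] := mark_letter cS r1; subst y1 z.
  have [z4 [z5 [ez ->]]] := mark_letter dS r2.
  have em : marked z4 ++ marked z5 = [:: inr c].
    have := congr1 marked ez; rewrite !marked_cat !marked_cons /= => <-.
    by move: mz; rewrite marked_cat marked_cons /=; case: (marked z2) => //= ->.
  exists (z4 ++ (inr d, true) :: z5); split=> //.
    have : unzip1 (z2 ++ (inr c, true) :: z3) = unzip1 (z4 ++ (inr d, false) :: z5) by rewrite ez.
    by move: cz; rewrite /unzip1 !map_cat /= => + e; rewrite e.
  rewrite marked_cat !marked_cons /=; move: em.
  by case: (marked z4) => [|c1 [|? ?]] //= []; case: cd => -[-> ->]; try move=> -> -> //; move=> ->.
case=> z [ex cz mz]; subst x; have nS := core_noS cz.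
case/infixP: ss => u [v /= ez].
have [z2 [[p b] [z3 [e1 e2 eb e3]]]] := map_eq_cat_cons ez.
case: z3 e1 e3 => [|[q b'] z3] //= e1 [eb' e3]; subst z.
(* The underlying word has no [S], so both adjacent [S] are marks. *)
have [bt bt'] : b /\ b'.
  move: nS; rewrite /unzip1 map_cat mem_cat /= !inE !negb_or => /and4P[_ pS qS _].
  split; [move: eb pS | move: eb' qS]; rewrite /visible /=.
    by case: (b) => // ->.
  by case: (b') => // ->.
rewrite {}bt {}bt' {b b' eb eb'} in ez cz mz r1 nS.
(* At most two letters are marked: these two are all of them and form a listed pair. *)
have [em pq] : marked z2 ++ marked z3 = [::] /\ [:: p; q] \in annihilating.
  move: mz; rewrite marked_cat !marked_cons /=.
  have szA x : x \in annihilating -> size x = 2 by rewrite !inE => /or3P[] /eqP->.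
  case/predU1P=> [|h]; first by case: (marked z2).
  have := szA _ h; rewrite size_cat /= !addnS => -[/eqP].
  rewrite addn_eq0 => /andP[/nilP m2 /nilP m3].
  by move: h; rewrite m2 m3.
have [f1 c1] := replace1_delS r1; have [f2 c2] := replace1_delS r2.
(* Both [S] are gone, whichever was erased first; filtering out [S] then identifies the result with
   the unmarked letters. *)
have y0 : count_mem S z1 = 0.
  move: c1; rewrite c2 count_visible // marked_cat !marked_cons /= size_cat /= !addnS -size_cat em.
  by case.
have -> : z1 = unzip1 z2 ++ unzip1 z3.
  have -> : z1 =
      [seq c <- z1 | c != S] by apply/esym/all_filterP; rewrite all_predC has_pred1; apply/count_memPn.
  rewrite -f2 -f1 filter_visible // filter_cat map_cat /=.
  by move: em; case m2: (marked z2) => //= em; rewrite !unmarked.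
apply/post_inv_core/core_del/pq.
by move: cz; rewrite /unzip1 map_cat.
Qed.

Lemma post_scm_sound w : scm_lang post_scm w -> post_lang ts f w.
Proof.
rewrite /scm_lang /= => st.
have : post_inv (map inl w).
  have : post_inv [:: X] by apply: post_inv_core; left; exists [::].
  by elim: st => // x y z /post_scmE xy _ IH /post_inv_step/(_ xy).
case=> z [ew cz mz]; apply: core_terminal; rewrite ew.
suff -> : map visible z = unzip1 z by [].
elim: z w ew {st cz mz} => [|[c b] z IH] [|a w] //= [ea /IH->].
by case: b ea.
Qed.

Lemma post_lang_SSCM : SSCM 2 1 5 3 2 (post_lang ts f).
Proof.
exists 5; split=> //; exists post_scm; split; first exact: post_scm_bounded.
by move=> w; split; [apply: post_scm_complete | apply: post_scm_sound].
Qed.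

End PostSystem.

Lemma ps_step_ctx (T : finType) k (G : ps_grammar T k) p q x y :
  ps_step G x y -> ps_step G (p ++ x ++ q) (p ++ y ++ q).
Proof.
case=> u [v [a [b [ab [-> ->]]]]]; exists (p ++ u), (v ++ q), a, b.
by rewrite -!catA.
Qed.

Lemma star_ps_ctx (T : finType) k (G : ps_grammar T k) p q x y :
  star (ps_step G) x y -> star (ps_step G) (p ++ x ++ q) (p ++ y ++ q).
Proof.
elim=> [z|x1 y1 z xy _ IH]; first exact: star_refl.
exact: star_step (ps_step_ctx _ _ xy) IH.
Qed.

(** * Derivation histories as tile systems *)

Section Histories.

Variables (T : finType) (k : nat) (G : ps_grammar T k).

Local Notation symb := (option (sym T k)).
Local Notation S0 := (inr (pstart G) : sym T k).

(* [None] separates the sentential forms of a derivation history. *)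
Inductive rewrites : seq symb -> seq symb -> Prop :=
| rewrites_nil : rewrites [::] [::]
| rewrites_copy c R Y : rewrites R Y -> rewrites (c :: R) (c :: Y)
| rewrites_rule a b R Y : List.In (a, b) (prules G) -> rewrites R Y ->
    rewrites (map Some a ++ R) (map Some b ++ Y).

Lemma rewrites_refl R : rewrites R R.
Proof. by elim: R => [|c R]; [apply: rewrites_nil | apply: rewrites_copy]. Qed.

Lemma rewrites_cat R1 Y1 R2 Y2 :
  rewrites R1 Y1 -> rewrites R2 Y2 -> rewrites (R1 ++ R2) (Y1 ++ Y2).
Proof.
move=> h h2; elim: h => //= [c R Y _|a b R Y ab _]; first exact: rewrites_copy.
by rewrite -!catA; apply: rewrites_rule.
Qed.

Lemma rewrites_step x y : ps_step G x y -> rewrites (map Some x) (map Some y).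
Proof.
case=> u [v [a [b [ab [-> ->]]]]]; rewrite !map_cat.
by apply: rewrites_cat (rewrites_refl _) (rewrites_rule ab (rewrites_refl _)).
Qed.

(** The hypothesis says that [Y'] is empty or begins with the separator, so the block [b], made of
    genuine symbols, cannot reach into it. *)
Lemma cat_map_Some (b y : seq (sym T k)) (Y1 Y' : seq symb) : ~~ isSome (head None Y') ->
  map Some b ++ Y1 = map Some y ++ Y' ->
  exists2 y1, y = b ++ y1 & Y1 = map Some y1 ++ Y'.
Proof.
move=> hY; elim: b y => [|c b IH] [|d y] //=.
- by move=> ->; exists [::].
- by move=> ->; exists (d :: y).
- by move=> e; rewrite -e in hY.
by case=> -> /IH[y1 -> ->]; exists y1.
Qed.

(** Rules applied to disjoint factors at once can be applied one after another. *)
Lemma rewrites_inv_flat R y : rewrites R (map Some y) ->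
  exists2 x, R = map Some x & star (ps_step G) x y.
Proof.
move eY: (map Some y) => Y h; elim: h y eY => [|c {}R {}Y _ IH|a b {}R {}Y ab _ IH] y.
- by case: y => // _; exists [::] => //; apply: star_refl.
- case: y => //= d y [<- /IH[x -> st]]; exists (d :: x) => //.
  by have := star_ps_ctx [:: d] [::] st; rewrite !cats0.
move=> /esym eY; have [] := @cat_map_Some b y Y [::]; rewrite ?cats0 // => y1 -> eY1.
have [|x -> st] := IH y1; first by rewrite eY1 cats0.
exists (a ++ x); rewrite ?map_cat //.
apply: (star_step (y := b ++ x)); first by exists [::], x, a, b.
by have := star_ps_ctx b [::] st; rewrite !cats0.
Qed.

(** No rule produces a separator, so the one in the target was copied and cuts the source at the
    matching place. *)
Lemma rewrites_inv_sep R y Y' : rewrites R (map Some y ++ None :: Y') ->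
  exists x R', [/\ R = map Some x ++ None :: R', star (ps_step G) x y & rewrites R' Y'].
Proof.
move eY: (_ ++ _) => Y h; elim: h y eY => [|c {}R {}Y h IH|a b {}R {}Y ab _ IH] y.
- by case: y.
- case: y => [|d y] /= [<-].
    by move=> ->; exists [::], R; split=> //; apply: star_refl.
  case/IH=> x [R' [-> st h']]; exists (d :: x), R'; split=> //.
  by have := star_ps_ctx [:: d] [::] st; rewrite !cats0.
move=> /esym eY; have [] := @cat_map_Some b y Y (None :: Y') => // y1 -> /esym/IH[x [R' [-> st h']]].
exists (a ++ x), R'; rewrite map_cat catA; split=> //.
apply: (star_step (y := b ++ x)); first by exists [::], x, a, b.
by have := star_ps_ctx b [::] st; rewrite !cats0.
Qed.

Lemma map_Some_or_sep (Y : seq symb) :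
  (exists y, Y = map Some y) \/ (exists y Y', Y = map Some y ++ None :: Y').
Proof.
elim: Y => [|[c|] Y [[y ->]|[y [Y' ->]]]].
- by left; exists [::].
- by left; exists (c :: y).
- by right; exists (c :: y), Y'.
- by right; exists [::], (map Some y).
- by right; exists [::], (map Some y ++ None :: Y').
Qed.

(* A derivation [S0 = x_0 => ... => x_n = x] appears as
   [Y = x_n # x_(n-1) # ... # x_0] and [R = x_(n-1) # ... # x_0 # x_0]. *)
Definition history (x : seq (sym T k)) (R Y : seq symb) : Prop :=
  rewrites R Y /\ Y ++ [:: None; Some S0] = map Some x ++ None :: R.

Lemma sep_inj (x y : seq (sym T k)) R R' :
  map Some x ++ None :: R = map Some y ++ None :: R' -> x = y /\ R = R'.
Proof.
elim: x y => [|c x IH] [|d y] //=; first by case.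
by case=> -> /IH[-> ->].
Qed.

(** Peel off the latest form: it is derived from the form heading [R], and what remains is a shorter
    history. When [Y] has no separator, [R] is [S0] alone. *)
Lemma history_sound x R Y : history x R Y -> star (ps_step G) [:: S0] x.
Proof.
move en: (size Y) => n; elim/ltn_ind: n x R Y en => n IH x R Y en [RY].
case: (map_Some_or_sep Y) => [[y eY]|[y [Y' eY]]]; subst Y; rewrite -?catA /=;
    case/sep_inj=> eyx eR; subst y.
  subst R; have [[|c [|d x']] //= [<-] st] := rewrites_inv_flat RY.
  exact: st.
have [x1 [R1 [eR1 st RY']]] := rewrites_inv_sep RY.
apply: star_trans st; apply: (IH _ _ x1 R1 Y' erefl).
  by rewrite -en size_cat /= addnS ltnS leq_addl.
by split=> //; rewrite eR.
Qed.

Lemma history_complete x : star (ps_step G) [:: S0] x -> exists R Y, history x R Y.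
Proof.
have : exists R Y, history [:: S0] R Y.
  by exists [:: Some S0], [:: Some S0]; split=> //; apply: rewrites_refl.
move=> + st; elim: st => // {x} x y z xy _ IH [R [Y [RY e]]]; apply: IH.
exists (map Some x ++ None :: R), (map Some y ++ None :: Y); split.
  by apply: rewrites_cat (rewrites_step xy) (rewrites_copy _ RY).
by rewrite -catA /= e.
Qed.

(* The letter [None] interleaves the history: it follows every letter on the
   left and precedes every letter on the right, so that only the tile without
   it can come first; that tile puts the separator [Some None] in front. *)
Local Notation lsym := (option symb).

Definition laceL (x : seq symb) : seq (T + lsym) :=
  flatten [seq [:: inr (Some c); inr None] | c <- x].
Definition laceR (x : seq symb) : seq lsym :=
  flatten [seq [:: None; Some c] | c <- x].

Definition mark_tile : tile T lsym := ([::], [:: Some None]).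
(** Emits the word on the left while writing it as the newest form of the history on the right. *)
Definition term_tile (a : T) : tile T lsym := ([:: inl a], laceR [:: Some (inl a)]).
Definition copy_tile (c : symb) : tile T lsym := (laceL [:: c], laceR [:: c]).
Definition rule_tile (r : seq (sym T k) * seq (sym T k)) : tile T lsym :=
  (laceL (map Some r.2), laceR (map Some r.1)).

Definition ps_tiles : seq (tile T lsym) :=
  mark_tile :: [seq term_tile a | a <- enum T] ++ [seq copy_tile c | c <- enum {: symb}]
    ++ [seq rule_tile r | r <- prules G].

(** The right lacing of a separator and [S0] without its first [None], which the preceding left
    lacing supplies. *)
Definition ps_final : seq (T + lsym) :=
  [:: inr (Some None); inr None; inr (Some (Some S0))].

Lemma laceL_cat x y : laceL (x ++ y) = laceL x ++ laceL y.
Proof. by rewrite /laceL map_cat flatten_cat. Qed.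

Lemma laceR_cat x y : laceR (x ++ y) = laceR x ++ laceR y.
Proof. by rewrite /laceR map_cat flatten_cat. Qed.

(** The two lacings differ by a shift of one letter, which is how the left and right histories
    align. *)
Lemma laceLR x : inr None :: laceL x = map inr (laceR x) ++ [:: inr None].
Proof. by rewrite /laceL /laceR; elim: x => //= c x IH; rewrite -IH. Qed.

Lemma lefts_cat (s1 s2 : seq (tile T lsym)) : lefts (s1 ++ s2) = lefts s1 ++ lefts s2.
Proof. by rewrite /lefts /unzip1 map_cat flatten_cat. Qed.

Lemma rights_cat (s1 s2 : seq (tile T lsym)) : rights (s1 ++ s2) = rights s1 ++ rights s2.
Proof. by rewrite /rights /unzip2 map_cat flatten_cat. Qed.

Lemma mark_tile_in : mark_tile \in ps_tiles. Proof. exact: mem_head. Qed.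

Lemma term_tile_in a : term_tile a \in ps_tiles.
Proof. by rewrite inE mem_cat map_f ?orbT // mem_enum. Qed.

Lemma copy_tile_in c : copy_tile c \in ps_tiles.
Proof. by rewrite inE !mem_cat [X in _ || X]orbC -orbA map_f ?orbT // mem_enum. Qed.

Lemma rule_tile_in r : List.In r (prules G) -> rule_tile r \in ps_tiles.
Proof. by move/InP=> rG; rewrite inE !mem_cat (map_f rule_tile rG) !orbT. Qed.

Lemma tiles_of_rewrites R Y : rewrites R Y -> exists s,
  [/\ {subset s <= ps_tiles}, lefts s = laceL Y & rights s = laceR R].
Proof.
have sub1 (t : tile T lsym) s : t \in ps_tiles -> {subset s <= ps_tiles} -> {subset t :: s <= ps_tiles}.
  by move=> tin sin t'; rewrite inE => /predU1P[->|/sin].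
elim=> [|c R' Y' _ [s [sin ls rs]]|a b R' Y' ab _ [s [sin ls rs]]].
- by exists [::].
- exists (copy_tile c :: s); split; first exact: sub1 (copy_tile_in c) sin.
    by rewrite /lefts /= -/(lefts s) ls.
  by rewrite /rights /= -/(rights s) rs.
exists (rule_tile (a, b) :: s); split; first exact: sub1 (rule_tile_in ab) sin.
  by rewrite /lefts /= -/(lefts s) ls laceL_cat.
by rewrite /rights /= -/(rights s) rs laceR_cat.
Qed.

Lemma post_lang_complete w : ps_lang G w -> post_lang ps_tiles ps_final w.
Proof.
case/history_complete=> R [Y [RY e]]; have [s [sin ls rs]] := tiles_of_rewrites RY.
(* After [w] on the left and the first separator on the right, the sides carry the lacings of
   [Y # S0] and [w # R], which [history] equates. *)
exists (mark_tile :: map term_tile w ++ copy_tile None :: s); split.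
  move=> t; rewrite inE mem_cat inE => /or4P[/eqP->|/mapP[a _ ->]|/eqP->|/sin //].
  - exact: mark_tile_in.
  - exact: term_tile_in.
  - exact: copy_tile_in.
rewrite -cat1s lefts_cat lefts_cat rights_cat rights_cat.
have -> : lefts (map term_tile w) = map inl w by elim: (w) => //= a w' <-.
have -> : rights (map term_tile w) =
    laceR (map Some (map inl w)) by rewrite /laceR /rights; elim: (w) => //= a w' ->.
rewrite -(cat1s _ s) lefts_cat rights_cat ls rs -catA; congr (_ ++ _).
have <- : laceR (Y ++ [:: None; Some S0]) = laceR (map Some (map inl w)) ++ rights [:: copy_tile None] ++ laceR R.
  by rewrite e -cat1s !laceR_cat.
by rewrite laceR_cat !map_cat /= laceLR -!catA /= -catA.
Qed.

(** * Reading a derivation off a solution of the tile equation *)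

Local Notation is_sep := (pred1 (Some None : lsym)).
Local Notation is_sepL := (pred1 (inr (Some None) : T + lsym)).

Lemma count_laceL x : count is_sepL (laceL x) = count is_sep (laceR x).
Proof. by rewrite /laceL /laceR; elim: x => //= c x ->. Qed.

Lemma count_sep_Some x : count is_sep (laceR (map Some x)) = 0.
Proof. by rewrite /laceR; elim: x. Qed.

(** A terminal is read as the symbol it stands for, so [term_tile a] decodes to a copy of [a]
    wherever it is used. *)
Definition uncode (y : T + lsym) : option symb :=
  match y with inl a => Some (Some (inl a)) | inr c => c end.

Definition letter_of (y : T + lsym) : option lsym := if y is inr c then Some c else None.

Lemma uncode_laceL x : pmap uncode (laceL x) = x.
Proof. by rewrite /laceL; elim: x => //= c x ->. Qed.

Lemma pmap_laceR x : pmap id (laceR x) = x.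
Proof. by rewrite /laceR; elim: x => //= c x ->. Qed.

(** Only the separator tile has a right side not starting with the lacing letter, and only it
    unbalances the separators. For rule tiles, [ps_wf] makes the right side nonempty. The
    continuation [q] covers left sides without code letters. *)
Lemma ps_tilesP t : ps_wf G -> t \in ps_tiles -> t = mark_tile \/
  [/\ t != mark_tile, exists q, t.2 = None :: q,
      rewrites (pmap id t.2) (pmap uncode t.1),
      count is_sepL t.1 = count is_sep t.2 &
      forall q, ohead q != Some None -> ohead (pmap letter_of t.1 ++ q) != Some None].
Proof.
move=> wfG; rewrite inE !mem_cat => /or4P[/eqP->|/mapP[a _ ->]|/mapP[c _ ->]|]; first by left.
- right; split=> //; first by eexists.
  exact: rewrites_refl.
- right; split=> //; first by eexists.
  exact: rewrites_refl.
case/mapP=> -[a b] abG ->; right.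
have /(allP wfG) /= : (a, b) \in prules G by [].
case: a abG => // c a abG _; split=> //.
- by rewrite xpair_eqE andbF.
- by eexists.
- change (rewrites (pmap id (laceR (map Some (c :: a)))) (pmap uncode (laceL (map Some b)))).
  rewrite uncode_laceL pmap_laceR.
  by rewrite -[map Some (c :: a)]cats0 -[map Some b]cats0; apply: rewrites_rule (rewrites_nil); apply/InP.
- change (count is_sepL (laceL (map Some b)) = count is_sep (laceR (map Some (c :: a)))).
  by rewrite count_laceL !count_sep_Some.
- by case: b {abG}.
Qed.

Lemma rewrites_of_tiles s : ps_wf G -> {subset s <= ps_tiles} -> mark_tile \notin s ->
  rewrites (pmap id (rights s)) (pmap uncode (lefts s)).
Proof.
move=> wfG; elim: s => [|t s IH] sin; first by move=> _; apply: rewrites_nil.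
rewrite inE negb_or => /andP[tm ms].
rewrite /rights /lefts /= !pmap_cat; apply: rewrites_cat; last first.
  by apply: IH ms => t' t's; apply: sin; rewrite inE t's orbT.
have [et|[]//] := ps_tilesP wfG (sin t (mem_head _ _)).
by rewrite et eqxx in tm.
Qed.

Lemma count_sep_tiles s : ps_wf G -> {subset s <= ps_tiles} ->
  count is_sep (rights s) = count is_sepL (lefts s) + count_mem mark_tile s.
Proof.
move=> wfG; elim: s => [|t s IH] sin //.
rewrite /rights /lefts /= !count_cat -/(rights s) -/(lefts s) IH; last first.
  by move=> t' t's; apply: sin; rewrite inE t's orbT.
suff -> : count is_sep t.2 = count is_sepL t.1 + (mark_tile == t) by rewrite addnACA (eq_sym t).
have [->|[/negPf tm _ _ -> _]] := ps_tilesP wfG (sin t (mem_head _ _)).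
  by rewrite eqxx.
by rewrite eq_sym tm addn0.
Qed.

Lemma lefts_head s q : ps_wf G -> {subset s <= ps_tiles} -> ohead q != Some None ->
  ohead (pmap letter_of (lefts s) ++ q) != Some None.
Proof.
move=> wfG; elim: s => [|t s IH] sin //= hq.
rewrite /lefts /= pmap_cat -catA.
have {}IH : ohead (pmap letter_of (lefts s) ++ q) != Some None.
  by apply: IH => // t' t's; apply: sin; rewrite inE t's orbT.
by have [->|[_ _ _ _]] := ps_tilesP wfG (sin t (mem_head _ _)); last apply.
Qed.

Lemma pmap_letter_inr q : pmap letter_of (map inr q) = q.
Proof. by elim: q => //= c q ->. Qed.

Lemma pmap_letter_inl (w : seq T) : pmap letter_of (map inl w) = [::].
Proof. by elim: w. Qed.

(** The left codes never begin with the lacing letter, so the separator tile comes first; since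
    [ps_final] has one separator, that tile does not recur. The other tiles decode to a rewriting,
    and the decoded equation makes it a history. *)
Lemma post_lang_sound w : ps_wf G -> post_lang ps_tiles ps_final w -> ps_lang G w.
Proof.
move=> wfG [s [sin e]].
have er : rights s = pmap letter_of (lefts s) ++ pmap letter_of ps_final.
  by have := congr1 (pmap letter_of) e; rewrite !pmap_cat pmap_letter_inl pmap_letter_inr cat0s => <-.
have hr : ohead (rights s) != Some None by rewrite er; apply: lefts_head.
have cm : count_mem mark_tile s = 1.
  have := congr1 (count is_sepL) e; rewrite !count_cat.
  have -> : count is_sepL (map inl w) = 0 by elim: (w).
  have -> : count is_sepL (map inr (rights s)) =
      count is_sep (rights s) by rewrite count_map; apply: eq_count.
  by rewrite (count_sep_tiles wfG sin) => /addnI <-.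
case: s sin e er hr cm => [|t s] sin e _ hr cm.
  by case: (w) e.
have et : t = mark_tile.
  have [//|[_ [q eq] _ _ _]] := ps_tilesP wfG (sin t (mem_head _ _)).
  by move: hr; rewrite /rights /= eq.
subst t; have ms : mark_tile \notin s by apply/count_memPn; case: cm.
have {}sin : {subset s <= ps_tiles} by move=> t ts; apply: sin; rewrite inE ts orbT.
apply: (history_sound (R := pmap id (rights s)) (Y := pmap uncode (lefts s))); split.
  exact: rewrites_of_tiles.
have := congr1 (pmap uncode) e; rewrite !pmap_cat.
rewrite /rights /lefts /= -/(rights s) -/(lefts s) => ->.
by congr (_ ++ _); [elim: (w) => //= a w' -> | congr (_ :: _); elim: (rights s) => //= c q ->].
Qed.

End Histories.

Lemma RE_SSCM (T : finType) (L : seq T -> Prop) : RE L -> SSCM 2 1 5 3 2 L.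
Proof.
case=> k [G [wfG LG]].
have [k' [le5 [H [bH eH]]]] := post_lang_SSCM (ps_tiles G) (ps_final G).
exists k'; split=> //; exists H; split=> // w; rewrite LG -eH.
by split; [apply: post_lang_complete | apply: post_lang_sound].
Qed.

Lemma star_map (X Y : Type) (R : X -> X -> Prop) (R' : Y -> Y -> Prop) (g : X -> Y) :
  (forall x y, R x y -> R' (g x) (g y)) ->
  forall x y, star R x y -> star R' (g x) (g y).
Proof.
move=> gR x y; elim=> [z|x1 y1 z xy _ IH]; first exact: star_refl.
exact: star_step (gR _ _ xy) IH.
Qed.

(** * Semi-conditional grammars as phrase-structure grammars *)

Section Rewriting.

Variables (T : finType) (N : eqType).

Definition rew_step (rules : seq (seq (T + N) * seq (T + N))) (x y : seq (T + N)) : Prop :=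
  exists u v a b, (a, b) \in rules /\ x = u ++ a ++ v /\ y = u ++ b ++ v.

Definition is_inr (c : T + N) : bool := if c is inr _ then true else false.

Lemma rewriting_RE (rules : seq (seq (T + N) * seq (T + N))) (start : N) (L : seq T -> Prop) :
  all (fun ab => has is_inr ab.1) rules ->
  (forall w, L w <-> star (rew_step rules) [:: inr start] (map inl w)) ->
  RE L.
Proof.
move=> wf LE.
pose nts (x : seq (T + N)) := pmap (fun c => if c is inr n then Some n else None) x.
pose occ := flatten [seq nts ab.1 ++ nts ab.2 | ab <- rules].
(* Nonterminals outside the list fall out of range and [inord] sends them to [0]; [psi] needs to
   invert [phi] only on [start] and the letters of the rules. *)
pose num (n : N) : 'I_(size occ).+1 := inord (index n (start :: occ)).
pose phi (c : T + N) : sym T (size occ).+1 :=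
  match c with inl a => inl a | inr n => inr (num n) end.
pose psi (c : sym T (size occ).+1) : T + N :=
  match c with inl a => inl a | inr i => inr (nth start (start :: occ) i) end.
have numK n : n \in start :: occ -> nth start (start :: occ) (num n) = n.
  by move=> nin; rewrite inordK ?nth_index // -[X in _ < X]/(size (start :: occ)) index_mem.
have phiK x : {subset nts x <= occ} -> map psi (map phi x) = x.
  elim: x => //= -[a|n] x IH sub /=; first by rewrite IH.
  rewrite numK; first by rewrite IH // => m mx; apply: sub; rewrite /nts /= inE mx orbT.
  by rewrite inE (sub n) ?orbT // /nts /= mem_head.
have rulesK a b : (a, b) \in rules ->
    map psi (map phi a) = a /\ map psi (map phi b) = b.
  move=> ab; split; apply: phiK => n nin; apply/flattenP; exists (nts a ++ nts b);
    by rewrite ?mem_cat ?nin ?orbT //; apply/mapP; exists (a, b).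
pose H := PSGrammar (num start) [seq (map phi ab.1, map phi ab.2) | ab <- rules].
exists (size occ).+1, H; split.
  rewrite /ps_wf /H /= all_map; apply: sub_all wf => -[a b] /=.
  by rewrite has_map; apply: sub_has => -[].
have stepP x y : rew_step rules x y -> ps_step H (map phi x) (map phi y).
  case=> u [v [a [b [ab [-> ->]]]]]; exists (map phi u), (map phi v), (map phi a), (map phi b).
  rewrite !map_cat; split=> //; apply/InP/mapP; by exists (a, b).
have stepK x y : ps_step H x y -> rew_step rules (map psi x) (map psi y).
  case=> u [v [a' [b' [/InP/mapP[[a b] ab [-> ->]] [-> ->]]]]].
  have [aK bK] := rulesK _ _ ab.
  exists (map psi u), (map psi v), a, b; rewrite !map_cat aK bK; by split.
have phi_inl w : map phi (map inl w) = map inl w by rewrite -map_comp.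
have psi_inl (w : seq T) : map psi (map inl w) = map inl w by rewrite -map_comp.
move=> w; rewrite LE; split=> [/(star_map stepP)|/(star_map stepK)].
  by rewrite phi_inl.
by rewrite psi_inl /= numK ?mem_head.
Qed.

End Rewriting.

Lemma mem_flatten_map (X : Type) (Y : eqType) (g : X -> seq Y) (s : seq X) y :
  (y \in flatten (map g s)) <-> exists2 x, List.In x s & y \in g x.
Proof.
elim: s => [|x s IH] /=; first by split=> // -[].
rewrite mem_cat; split=> [/orP[yx|/IH[x' x's yx']]|[x' [<-|x's] yx']].
- by exists x => //; left.
- by exists x' => //; right.
- by rewrite yx'.
- by apply/orP; right; apply/IH; exists x'.
Qed.

(** * A head moving over a sentential form between end markers *)

Section Simulation.

Variables (T : finType) (k : nat) (G : scm_grammar T k).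

Local Notation symb := (sym T k).
Local Notation program := (seq ('I_k * seq symb)).

(** A sum of standard types, so that equality is decidable. Numbers name the four fixed letters; a
    pair holds the word being swept for, if any, and the rules to apply. *)
Definition ctrl : Type := (nat + (option (seq symb) * program))%type.
Local Notation nonterm := (symb + ctrl)%type.
Local Notation cell := (T + nonterm)%type.

Definition Sy (c : symb) : cell := inr (inl c).
Definition Lend : cell := inr (inr (inl 0)).
Definition Rend : cell := inr (inr (inl 1)).
Definition Fin : cell := inr (inr (inl 2)).
Definition Start : cell := inr (inr (inl 3)).
Definition Run (rs : program) : cell := inr (inr (inr (None, rs))).
Definition Sweep (f : seq symb) (rs : program) : cell := inr (inr (inr (Some f, rs))).

(** All suffixes of rule lists, that is, what may remain of a matrix during its execution;
    restricting heads to them keeps [sim_rules] finite. *)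
Definition programs : seq program := locked ([::] ::
  flatten [seq [seq drop i (mrules r) | i <- iota 0 (size (mrules r)).+1] | r <- gmats G]).

Lemma programs_nil : [::] \in programs. Proof. by rewrite /programs -lock mem_head. Qed.

Lemma programs_mrules r : List.In r (gmats G) -> mrules r \in programs.
Proof.
move=> rG; rewrite /programs -lock inE; apply/orP; right; apply/mem_flatten_map; exists r => //.
by apply/mapP; exists 0; rewrite ?drop0.
Qed.

Lemma programs_behead p rs : p :: rs \in programs -> rs \in programs.
Proof.
rewrite /programs -lock inE => /orP[//|/mem_flatten_map[r rG /mapP[i]]].
rewrite mem_iota add0n ltnS => /andP[_ ile] e.
have lt : i < size (mrules r).
  by rewrite ltn_neqAle ile andbT; apply: contra_eqN e => /eqP->; rewrite drop_size.
rewrite inE; apply/orP; right; apply/mem_flatten_map; exists r => //.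
apply/mapP; exists i.+1; first by rewrite mem_iota add0n !ltnS.
by move: e; rewrite (drop_nth p lt) => -[].
Qed.

Definition guard (r : scm_matrix T k) : seq symb := if mP r is Some p then p else [::].

(* [sim_rule a h b c] stands for the production [a ++ h :: b -> c]; the head [h]
   is the only control letter in it besides the end markers. *)
Inductive sim_rule : seq cell -> cell -> seq cell -> seq cell -> Prop :=
| sim_start : sim_rule [::] Start [::] [:: Lend; Run [::]; Sy (inr (gstart G)); Rend]
| sim_finish : sim_rule [:: Lend] (Run [::]) [::] [:: Fin]
| sim_end : sim_rule [::] Fin [:: Rend] [::]
| sim_emit a : sim_rule [::] Fin [:: Sy (inl a)] [:: inl a; Fin]
| sim_right rs c : rs \in programs -> sim_rule [::] (Run rs) [:: Sy c] [:: Sy c; Run rs]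
| sim_left rs c : rs \in programs -> sim_rule [:: Sy c] (Run rs) [::] [:: Run rs; Sy c]
| sim_apply A w rs : (A, w) :: rs \in programs ->
    sim_rule [::] (Run ((A, w) :: rs)) [:: Sy (inr A)] (Run rs :: map Sy w)
| sim_check r : List.In r (gmats G) -> mF r = None ->
    sim_rule [::] (Run [::]) (map Sy (guard r)) (Run (mrules r) :: map Sy (guard r))
| sim_sweep r f : List.In r (gmats G) -> mF r = Some f ->
    sim_rule [:: Lend] (Run [::]) [::] [:: Lend; Sweep f (mrules r)]
| sim_pass r f c : List.In r (gmats G) -> mF r = Some f -> c \notin f ->
    sim_rule [::] (Sweep f (mrules r)) [:: Sy c] [:: Sy c; Sweep f (mrules r)]
| sim_clear r f : List.In r (gmats G) -> mF r = Some f ->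
    sim_rule [::] (Sweep f (mrules r)) [:: Rend] [:: Run (mrules r); Rend].

Definition sim_rules : seq (seq cell * seq cell) :=
  [:: ([:: Start], [:: Lend; Run [::]; Sy (inr (gstart G)); Rend]);
      ([:: Lend; Run [::]], [:: Fin]);
      ([:: Fin; Rend], [::])] ++
  [seq ([:: Fin; Sy (inl a)], [:: inl a; Fin]) | a <- enum T] ++
  [seq ([:: Run rs; Sy c], [:: Sy c; Run rs]) | rs <- programs, c <- enum {: symb}] ++
  [seq ([:: Sy c; Run rs], [:: Run rs; Sy c]) | rs <- programs, c <- enum {: symb}] ++
  flatten [seq if rs is (A, w) :: rs' then
      [:: ([:: Run rs; Sy (inr A)], Run rs' :: map Sy w)] else [::] | rs <- programs] ++
  flatten [seq if mF r is Some f then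
      [:: ([:: Lend; Run [::]], [:: Lend; Sweep f (mrules r)]);
          ([:: Sweep f (mrules r); Rend], [:: Run (mrules r); Rend])] ++
      [seq ([:: Sweep f (mrules r); Sy c], [:: Sy c; Sweep f (mrules r)])
         | c <- enum {: symb} & c \notin f]
    else [:: (Run [::] :: map Sy (guard r), Run (mrules r) :: map Sy (guard r))]
    | r <- gmats G].

Lemma sim_rulesP x y : (x, y) \in sim_rules <->
  exists a h b, x = a ++ h :: b /\ sim_rule a h b y.
Proof.
split.
  rewrite !mem_cat => /or4P[|/mapP[a _ [-> ->]]|h|/or3P[]].
  - rewrite !inE => /or3P[] /eqP[-> ->].
    + by exists [::], Start, [::]; split=> //; apply: sim_start.
    + by exists [:: Lend], (Run [::]), [::]; split=> //; apply: sim_finish.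
    + by exists [::], Fin, [:: Rend]; split=> //; apply: sim_end.
  - by exists [::], Fin, [:: Sy (inl a)]; split=> //; apply: sim_emit.
  - have [[rs c] [rsP _ [-> ->]]] := allpairsP h.
    by exists [::], (Run rs), [:: Sy c]; split=> //; apply: sim_right.
  - move=> h; have [[rs c] [rsP _ [-> ->]]] := allpairsP h.
    by exists [:: Sy c], (Run rs), [::]; split=> //; apply: sim_left.
  - case/mem_flatten_map=> -[|[A w] rs] // /InP rsP; rewrite inE => /eqP[-> ->].
    by exists [::], (Run ((A, w) :: rs)), [:: Sy (inr A)]; split=> //; apply: sim_apply.
  - case/mem_flatten_map=> r rG; case eF: (mF r) => [f|]; rewrite !inE.
      case/or3P=> [/eqP[-> ->]|/eqP[-> ->]|/mapP[c]].
      + by exists [:: Lend], (Run [::]), [::]; split=> //; apply: sim_sweep.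
      + by exists [::], (Sweep f (mrules r)), [:: Rend]; split=> //; apply: sim_clear.
      rewrite mem_filter => /andP[cf _] [-> ->].
      by exists [::], (Sweep f (mrules r)), [:: Sy c]; split=> //; apply: sim_pass cf.
    move/eqP=> [-> ->]; exists [::], (Run [::]), (map Sy (guard r)); split=> //; exact: sim_check.
case=> a [h [b [-> h1]]]; rewrite !mem_cat.
case: h1 => [|||a0|rs c rsP|rs c rsP|A w rs rsP|r rG rF|r f rG rF|r f c rG rF cf|r f rG rF].
- by rewrite /= !inE eqxx.
- by rewrite /=.
- by rewrite /=.
- by apply/or4P/Or42/mapP; exists a0; rewrite ?mem_enum.
- apply/or4P/Or43/(allpairsP (f := fun rs c => _)); by exists (rs, c); rewrite mem_enum.
- apply/or4P/Or44/or3P/Or31/allpairsP; by exists (rs, c); rewrite mem_enum.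
- apply/or4P/Or44/or3P/Or32/mem_flatten_map; exists ((A, w) :: rs); first exact/InP.
  by rewrite inE.
- apply/or4P/Or44/or3P/Or33/mem_flatten_map; exists r => //.
  by rewrite rF inE.
- apply/or4P/Or44/or3P/Or33/mem_flatten_map; exists r => //.
  by rewrite rF inE eqxx.
- apply/or4P/Or44/or3P/Or33/mem_flatten_map; exists r => //.
  rewrite rF !inE; apply/or3P/Or33/mapP; exists c => //.
  by rewrite mem_filter cf mem_enum.
- apply/or4P/Or44/or3P/Or33/mem_flatten_map; exists r => //.
  by rewrite rF !inE eqxx orbT.
Qed.

Definition is_head (c : cell) : bool :=
  match c with
  | inr (inr (inl n)) => 1 < n
  | inr (inr (inr _)) => true
  | _ => false
  end.

Lemma no_head_Sy x : ~~ has is_head (map Sy x). Proof. by elim: x. Qed.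

Lemma no_head_inl (w : seq T) : ~~ has is_head (map inl w). Proof. by elim: w. Qed.

Lemma sim_rule_head a h b y : sim_rule a h b y ->
  [/\ is_head h, ~~ has is_head a & ~~ has is_head b].
Proof. by case=> // r _ _; split=> //; apply: no_head_Sy. Qed.

(** The word and the left-hand side of the production each contain a single head, so the two heads
    coincide. *)
Lemma sim_stepP pre h post y : is_head h -> ~~ has is_head pre -> ~~ has is_head post ->
  rew_step sim_rules (pre ++ h :: post) y ->
  exists u a b v y', [/\ pre = u ++ a, post = b ++ v, sim_rule a h b y' & y = u ++ y' ++ v].
Proof.
move=> hh hpre hpost [u [v [x [y' [/sim_rulesP[a [h' [b [-> hr]]]] [e ->]]]]]].
have [hh' _ _] := sim_rule_head hr.
have [] := @cat_cons_inj _ is_head pre post (u ++ a) (b ++ v) h h' hh hh' hpre hpost.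
  by rewrite e -!catA.
by move=> epre eh epost; subst h'; exists u, a, b, v, y'.
Qed.

Lemma sim_stepI u a h b v y : sim_rule a h b y ->
  rew_step sim_rules (u ++ a ++ h :: b ++ v) (u ++ y ++ v).
Proof.
move=> hr; exists u, v, (a ++ h :: b), y; rewrite -catA; split=> //.
by apply/sim_rulesP; exists a, h, b.
Qed.

Local Notation sim := (star (rew_step sim_rules)).
Local Notation reach := (star (scm_step G) [:: inr (gstart G)]).

Definition config (x1 : seq symb) (h : cell) (x2 : seq symb) : seq cell :=
  (Lend :: map Sy x1) ++ h :: map Sy x2 ++ [:: Rend].

(** While a program runs, every word that completing it would yield is reachable; a program that
    gets stuck thus claims nothing, and an empty one says that the present word is reachable. During
    a sweep the part already passed is free of forbidden letters. *)
Inductive sim_inv : seq cell -> Prop :=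
| inv_start : sim_inv [:: Start]
| inv_run x1 x2 rs : (forall z, apply_rules rs (x1 ++ x2) z -> reach z) ->
    sim_inv (config x1 (Run rs) x2)
| inv_sweep x1 x2 f r : List.In r (gmats G) -> mF r = Some f -> reach (x1 ++ x2) ->
    ~~ has (mem f) x1 -> sim_inv (config x1 (Sweep f (mrules r)) x2)
| inv_fin t x2 : reach (map inl t ++ x2) -> sim_inv (map inl t ++ Fin :: map Sy x2 ++ [:: Rend])
| inv_done t : reach (map inl t) -> sim_inv (map inl t).

Lemma Lend_rcons x u : Lend :: map Sy x = u ++ [:: Lend] -> x = [::] /\ u = [::].
Proof.
case/lastP: x => [|x c]; first by case: u => // ? [].
rewrite map_rcons -rcons_cons cats1 => /eqP; rewrite eqseq_rcons => /andP[_ /eqP] //.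
Qed.

Lemma Sy_rcons x u c : Lend :: map Sy x = u ++ [:: Sy c] ->
  exists2 x', x = rcons x' c & u = Lend :: map Sy x'.
Proof.
case/lastP: x => [|x d]; first by case: u => // ? [].
rewrite map_rcons -rcons_cons cats1 => /eqP; rewrite eqseq_rcons => /andP[/eqP <- /eqP [->]].
by exists x.
Qed.

Lemma Sy_prefix p x v : map Sy x ++ [:: Rend] = map Sy p ++ v ->
  exists2 x', x = p ++ x' & v = map Sy x' ++ [:: Rend].
Proof.
elim: p x => [|c p IH] [|d x] //=.
- by move=> <-; exists [::].
- by move=> <-; exists (d :: x).
by case=> -> /IH[x' -> ->]; exists x'.
Qed.

Lemma Rend_prefix x v : map Sy x ++ [:: Rend] = Rend :: v -> x = [::] /\ v = [::].
Proof. by case: x => //= -[<-]. Qed.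

Hypothesis simple : forall r, List.In r (gmats G) -> ~~ nonsimple r.
Hypothesis short : forall r f, List.In r (gmats G) -> mF r = Some f -> size f = 1.

Lemma mP_none r f : List.In r (gmats G) -> mF r = Some f -> mP r = None.
Proof. by move=> /simple + rF; rewrite /nonsimple rF; case: (mP r). Qed.

Lemma infix_short r f x : List.In r (gmats G) -> mF r = Some f -> infix f x = has (mem f) x.
Proof.
move=> rG /(short rG); case: f => [|c [|//]] // _.
elim: x => //= d x <-; rewrite prefix0s andbT; congr (_ || _).
by rewrite inE eq_sym.
Qed.

Lemma config_stepP x1 h x2 y : is_head h -> rew_step sim_rules (config x1 h x2) y ->
  exists u a b v y', [/\ Lend :: map Sy x1 = u ++ a, map Sy x2 ++ [:: Rend] = b ++ v,
    sim_rule a h b y' & y = u ++ y' ++ v].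
Proof.
move=> hh; apply: sim_stepP => //; first exact: no_head_Sy.
by rewrite has_cat negb_or no_head_Sy.
Qed.

Lemma sim_inv_step x y : sim_inv x -> rew_step sim_rules x y -> sim_inv y.
Proof.
case=> [|x1 x2 rs H|x1 x2 f r rG rF H nf|t x2 H|t H].
- case/(@sim_stepP [::] Start [::]) => // u [a [b [v [y' [ea eb hr ->]]]]].
  case: u a ea hr => [|//] [|//] _ hr; case: b v eb hr => [|//] [|//] _ hr.
  inversion hr; subst; apply: (@inv_run [::] [:: inr (gstart G)] [::]) => z hz.
  by inversion hz; subst; apply: star_refl.
- case/config_stepP=> // u [a [b [v [y' [ea eb hr ->]]]]].
  inversion hr; subst.
  + have [e1 ->] := Lend_rcons ea; subst x1; rewrite -[v]/([::] ++ v) -eb.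
    by apply: (@inv_fin [::]); apply: H; apply: ar_nil.
  + have [x' ex ev] := @Sy_prefix [:: c] _ _ eb; subst x2 v.
    move: ea; rewrite cats0 => <-.
    have -> : (Lend :: map Sy x1) ++ [:: Sy c; Run rs] ++ map Sy x' ++ [:: Rend] =
        config (rcons x1 c) (Run rs) x'.
      by rewrite /config map_rcons -rcons_cons cat_rcons.
    by apply: inv_run => z; rewrite cat_rcons; apply: H.
  + have [x' ex ->] := Sy_rcons ea; subst x1; rewrite -[v]/([::] ++ v) -eb.
    apply: (@inv_run x' (c :: x2)) => z; rewrite -cat_rcons; exact: H.
  + have [x' ex ev] := @Sy_prefix [:: inr A] _ _ eb; subst x2 v.
    move: ea; rewrite cats0 => <-.
    have -> : (Lend :: map Sy x1) ++ (Run rs0 :: map Sy w) ++ map Sy x' ++ [:: Rend] =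
        config x1 (Run rs0) (w ++ x').
      by rewrite /config map_cat -!catA.
    apply: inv_run => z hz; apply: H; apply: ar_cons hz.
    by exists x1, x'.
  + have [x' ex ev] := Sy_prefix eb; subst x2 v.
    move: ea; rewrite cats0 => <-.
    have -> : (Lend :: map Sy x1) ++ (Run (mrules r) :: map Sy (guard r)) ++ map Sy x' ++ [:: Rend] =
        config x1 (Run (mrules r)) (guard r ++ x').
      by rewrite /config map_cat -!catA.
    (* The empty program gives reachability of the present word, and the guard beside the head is
       the required factor. *)
    apply: inv_run => z hz; apply: (star_trans (H _ (ar_nil _))); apply: star1.
    exists r; split=> //; split; last by have -> : mF r = None by [].
    by move: hz; rewrite /guard; case: (mP r) => // p _; apply/infixP; exists x1, x'.
  + have [e1 ->] := Lend_rcons ea; subst x1; rewrite -[v]/([::] ++ v) -eb.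
    by apply: (@inv_sweep [::] x2 f r) => //; apply: H; apply: ar_nil.
- case/config_stepP=> // u [a [b [v [y' [ea eb hr ->]]]]].
  inversion hr as [| | | | | | | | |r0 f0 c r0G r0F cf e1 e2 e3 e4|r0 f0 r0G r0F e1 e2 e3 e4]; subst.
  + have [x' ex ev] := @Sy_prefix [:: c] _ _ eb; subst x2 v.
    (* The head records the forbidden word and the rules but not the matrix, so inversion gives some
       [r0] that agrees with [r] on these. *)
    move: ea; rewrite cats0 (_ : mrules r0 = mrules r) // => <-.
    have -> : (Lend :: map Sy x1) ++ [:: Sy c; Sweep f (mrules r)] ++ map Sy x' ++ [:: Rend] =
        config (rcons x1 c) (Sweep f (mrules r)) x'.
      by rewrite /config map_rcons -rcons_cons cat_rcons.
    by apply: inv_sweep => //; rewrite ?cat_rcons // has_rcons negb_or nf andbT.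
  + have [e2 ->] := Rend_prefix eb; subst x2.
    move: ea; rewrite cats0 (_ : mrules r0 = mrules r) // => <-.
    (* At the right end the whole word has been swept, and [r], being simple, requires no factor. *)
    apply: (@inv_run x1 [::]) => z hz; apply: (star_trans H); apply: star1.
    exists r; split=> //; split; first by rewrite (mP_none rG rF).
    by rewrite rF (infix_short _ rG rF) cats0; move: hz; rewrite cats0.
- case/sim_stepP=> //; [exact: no_head_inl | by rewrite has_cat negb_or no_head_Sy |].
  move=> u [a [b [v [y' [ea eb hr ->]]]]]; inversion hr; subst.
  + have [e2 ->] := Rend_prefix eb; subst x2.
    by move: ea H; rewrite !cats0 => <- /inv_done.
  + have [x' ex ev] := @Sy_prefix [:: inl a0] _ _ eb; subst x2 v.
    move: ea; rewrite cats0 => <-.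
    have -> : map inl t ++ [:: inl a0; Fin] ++ map Sy x' ++ [:: Rend] =
        map inl (rcons t a0) ++ Fin :: map Sy x' ++ [:: Rend].
      by rewrite map_rcons cat_rcons.
    by apply: inv_fin; rewrite map_rcons cat_rcons.
case=> u [v [a [b [/sim_rulesP[a1 [h [b1 [-> /sim_rule_head[hh _ _]]]]] [e _]]]]].
by have := no_head_inl t; rewrite e !has_cat /= hh !orbT.
Qed.

Lemma sim_sound w : sim [:: Start] (map inl w) -> scm_lang G w.
Proof.
move=> st; have : sim_inv (map inl w).
  have := inv_start; by elim: st => // x y z xy _ IH /sim_inv_step/(_ xy).
move=> {st}; move ex: (map inl w) => x inv; case: inv ex.
- by case: w.
- by case: w.
- by case: w.
- by move=> t x2 _ e; have := no_head_inl w; rewrite e has_cat orbT.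
have inlI : injective (@inl T nonterm) by move=> a b [].
by move=> t H /(inj_map inlI) ->.
Qed.

Lemma sim_run_right x1 x2 rs : rs \in programs ->
  sim (config [::] (Run rs) (x1 ++ x2)) (config x1 (Run rs) x2).
Proof.
move=> rsP; elim/last_ind: x1 x2 => [|x1 c IH] x2; first exact: star_refl.
rewrite cat_rcons; apply: (star_trans (IH _)); apply: star1.
have := sim_stepI (Lend :: map Sy x1) (map Sy x2 ++ [:: Rend]) (sim_right c rsP).
by rewrite /config map_rcons -rcons_cons cat_rcons.
Qed.

Lemma sim_run_left x1 x2 rs : rs \in programs ->
  sim (config x1 (Run rs) x2) (config [::] (Run rs) (x1 ++ x2)).
Proof.
move=> rsP; elim/last_ind: x1 x2 => [|x1 c IH] x2; first exact: star_refl.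
rewrite cat_rcons; apply: star_trans (IH _); apply: star1.
have := sim_stepI (Lend :: map Sy x1) (map Sy x2 ++ [:: Rend]) (sim_left c rsP).
by rewrite /config map_rcons -rcons_cons cat_rcons.
Qed.

Lemma sim_apply_rules rs x z : apply_rules rs x z -> rs \in programs ->
  sim (config [::] (Run rs) x) (config [::] (Run [::]) z).
Proof.
elim=> [{}x|A w {}rs {}x y {}z [u [v [-> ->]]] _ IH] rsP; first exact: star_refl.
have rsP' := programs_behead rsP.
apply: star_trans (IH rsP'); apply: (star_trans (sim_run_right _ _ rsP)).
apply: star_trans (sim_run_left _ _ rsP'); apply: star1.
have := sim_stepI (Lend :: map Sy u) (map Sy v ++ [:: Rend]) (sim_apply rsP).
by rewrite /config map_cat -!catA.
Qed.

Lemma sim_scm_step x z : scm_step G x z ->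
  sim (config [::] (Run [::]) x) (config [::] (Run [::]) z).
Proof.
case=> r [rG [hP [hF hz]]]; apply: star_trans (sim_apply_rules hz (programs_mrules rG)).
case eF: (mF r) => [f|] in hF.
  have nf : ~~ has (mem f) x by rewrite -(infix_short x rG eF).
  apply: (@star_step _ _ _ (config [::] (Sweep f (mrules r)) x)).
    exact: (sim_stepI [::] (map Sy x ++ [:: Rend]) (sim_sweep rG eF)).
  have pass x1 x2 : ~~ has (mem f) x1 ->
      sim (config [::] (Sweep f (mrules r)) (x1 ++ x2)) (config x1 (Sweep f (mrules r)) x2).
    elim/last_ind: x1 x2 => [|x1 c IH] x2; first by move=> _; apply: star_refl.
    rewrite has_rcons negb_or cat_rcons => /andP[cf nf1].
    apply: (star_trans (IH _ nf1)); apply: star1.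
    have := sim_stepI (Lend :: map Sy x1) (map Sy x2 ++ [:: Rend]) (sim_pass rG eF cf).
    by rewrite /config map_rcons -rcons_cons cat_rcons.
  have st := pass x [::] nf; rewrite cats0 in st; apply: (star_trans st).
  apply: (@star_step _ _ _ (config x (Run (mrules r)) [::])).
    exact: (sim_stepI (Lend :: map Sy x) [::] (sim_clear rG eF)).
  by have := sim_run_left x [::] (programs_mrules rG); rewrite cats0.
(* Without a required word the guard is empty and the left end serves as its position. *)
have [u [v ->]] : exists u v, x = u ++ guard r ++ v.
  move: hP; rewrite /guard; case: (mP r) => [p /infixP[u [v ->]]|_]; first by exists u, v.
  by exists [::], x.
apply: (star_trans (sim_run_right _ _ programs_nil)).
apply: star_trans (sim_run_left _ _ (programs_mrules rG)); apply: star1.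
have := sim_stepI (Lend :: map Sy u) (map Sy v ++ [:: Rend]) (sim_check rG eF).
by rewrite /config map_cat -!catA.
Qed.

Lemma sim_complete w : scm_lang G w -> sim [:: Start] (map inl w).
Proof.
move=> st.
have : sim (config [::] (Run [::]) [:: inr (gstart G)]) (config [::] (Run [::]) (map inl w)).
  elim: st => [x|x y z /sim_scm_step xy _ IH]; first exact: star_refl.
  exact: star_trans xy IH.
move=> {}st; apply: (@star_step _ _ _ (config [::] (Run [::]) [:: inr (gstart G)])).
  exact: (sim_stepI [::] [::] sim_start).
apply: (star_trans st).
apply: (@star_step _ _ _ ([:: Fin] ++ map Sy (map inl w) ++ [:: Rend])).
  exact: (sim_stepI [::] (map Sy (map inl w) ++ [:: Rend]) sim_finish).
suff emit t t' : sim (map inl t ++ Fin :: map Sy (map inl t') ++ [:: Rend]) (map inl (t ++ t')).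
  exact: (emit [::] w).
elim: t' t => [|a t' IH] t.
  apply: star1; have := sim_stepI (map inl t) [::] sim_end.
  by rewrite /= !cats0.
rewrite -(cat_rcons a t t'); apply: star_trans (IH _); apply: star1.
have := sim_stepI (map inl t) (map Sy (map inl t') ++ [:: Rend]) (sim_emit a).
by rewrite map_rcons cat_rcons.
Qed.

Lemma sim_RE : RE (scm_lang G).
Proof.
apply: (@rewriting_RE _ _ sim_rules (inr (inl 3))).
  apply/allP=> -[x y] /sim_rulesP[a [h [b [-> /sim_rule_head[hh _ _]]]]] /=.
  by rewrite has_cat /=; case: h hh => // c _; rewrite orbT.
by move=> w; split; [apply: sim_complete | apply: sim_sound].
Qed.

End Simulation.

(** Second degree [1] and well-formedness make each forbidden word a single letter, which a sweep
    can test; the bound [0] on non-simple matrices makes every matrix simple. *)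
Lemma SSCM_RE (T : finType) (i n m l : nat) (L : seq T -> Prop) :
  SSCM i 1 n m l L -> RE L.
Proof.
case=> k [_ [G [/and5P[wfG _ FG _ /andP[_ sG]] LG]]].
have [|r f rG rF|k' [H [wfH eH]]] := @sim_RE T k G.
- move=> r /(@List.in_split _ _ _)[s1 [s2 eG]]; apply/negP=> ns.
  by move: sG; rewrite eG count_cat /= ns addnS.
- case/(@List.in_split _ _ _): rG FG wfG => s1 [s2 ->].
  rewrite !all_cat /= => /and3P[_ + _] /and3P[_ + _].
  by rewrite /scm_matrix_wf rF /= => + /and3P[_ _]; case: f {rF} => [|? [|? ?]].
by exists k', H; split=> // w; rewrite LG.
Qed.

Theorem mainTheorem1 (T : finType) (L : seq T -> Prop) :
  SSCM 2 1 5 3 2 L <-> RE L.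
Proof. by split; [apply: SSCM_RE | apply: RE_SSCM]. Qed.
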